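(* Let $p$ be a prime and $t>0$ an integer. (1) If $p\equiv\pm1\pmod 5$, then $H_{p,2t}\equiv 2H_{4(t-1),2(t-1)}\equiv 2F_{2t-1}^2\pmod p$. (2) If $p\equiv \pm2\pmod 5$, then $H_{p,2t+1}\equiv 2H_{4t,2t}-1\equiv 2F_{2t+1}^2-1\pmod p$.
   Context: $F_n$ denotes the Fibonacci numbers ($F_0=0$, $F_1=1$, $F_{n}=F_{n-1}+F_{n-2}$), extended to negative indices by $F_{-n}=(-1)^{n-1}F_n$. For integers $r,k$, $H_{r,k}=F_{k+1}F_{r-k+2}-F_kF_{r-k+1}=F_{k-1}F_{r-k+2}+F_kF_{r-k}$. *)

(* Defs.v *)
From mathcomp Require Import all_boot all_order all_algebra.
From mathcomp Require Import ring lra zify.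

Set Implicit Arguments.
Unset Strict Implicit.
Unset Printing Implicit Defensive.

Import Order.TTheory GRing.Theory Num.Theory.
Local Open Scope ring_scope.

Fixpoint fib (n : nat) : nat :=
  match n with
  | 0 => 0
  | n'.+1 => match n' with 0 => 1 | n''.+1 => fib n' + fib n'' end
  end%N.

(* [Negz m] is the integer - (m + 1), so the second branch is
   F_{-n} = (-1)^(n-1) F_n with n = m + 1. *)
Definition fibz (n : int) : int :=
  match n with
  | Posz m => (fib m)%:Z
  | Negz m => (-1) ^+ m * (fib m.+1)%:Z
  end.

Definition Hrk (r k : int) : int :=
  fibz (k + 1) * fibz (r - k + 2) - fibz k * fibz (r - k + 1).

Lemma fibSS (n : nat) : fib n.+2 = (fib n.+1 + fib n)%N.
Proof. by []. Qed.

Lemma fibzN (n : nat) : (0 < n)%N ->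
  fibz (- n%:Z) = (-1) ^+ n.-1 * fibz n%:Z.
Proof. by case: n => // n _; rewrite -NegzE. Qed.

Lemma fibz_rec (n : int) : fibz (n + 2) = fibz (n + 1) + fibz n.
Proof.
case: n => [n|[|[|n]]] //.
  rewrite (_ : n%:Z + 2 = n.+2%:Z :> int); last lia.
  rewrite (_ : n%:Z + 1 = n.+1%:Z :> int); last lia.
  by rewrite /fibz fibSS PoszD.
rewrite (_ : Negz n.+2 + 2 = Negz n :> int); last lia.
rewrite (_ : Negz n.+2 + 1 = Negz n.+1 :> int); last lia.
rewrite /fibz (fibSS n.+1) (fibSS n) !PoszD !exprS; ring.
Qed.

Lemma HrkE (r k : int) :
  Hrk r k = fibz (k - 1) * fibz (r - k + 2) + fibz k * fibz (r - k).
Proof.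
have e1 := fibz_rec (k - 1); have e2 := fibz_rec (r - k).
rewrite (_ : k - 1 + 2 = k + 1) in e1; last by ring.
rewrite subrK in e1.
rewrite /Hrk e1 e2; ring.
Qed.

(* Main.v *)
Require Import Defs.
From mathcomp Require Import all_boot all_order all_algebra.
From mathcomp Require Import galois finfield ring zify.

Import Order.TTheory GRing.Theory Num.Theory.
Local Open Scope ring_scope.

(** Let z be a primitive fifth root of unity in an extension of F_p, p <> 5.
    Then - (z^2 + z^3) and - (z + z^4) are the two roots of X^2 - X - 1, and
    the Frobenius map z |-> z^p fixes both when p = +-1 mod 5 and swaps them
    when p = +-2 mod 5. As x^p = F_p x + F_(p-1) for each root x, comparing
    coefficients gives (F_(p-1), F_p) = (0, 1), resp. (1, -1), mod p.  Hence
    F_(p+m) = F_(m+1), resp. F_(p+1+m) = - F_m, mod p for all integers m, and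
    the theorem reduces to identities between Fibonacci numbers. *)

(** The values at m and m + 1 determine those at m + 2 and m - 1, so induction runs both ways from
    0. *)
Lemma int_rec2_uniq (V : zmodType) (a b : int -> V) :
  (forall m, a (m + 2) = a (m + 1) + a m) ->
  (forall m, b (m + 2) = b (m + 1) + b m) ->
  a 0 = b 0 -> a 1 = b 1 -> a =1 b.
Proof.
move=> ra rb e0 e1 m.
suff [] : a m = b m /\ a (m + 1) = b (m + 1) by [].
elim/int_ind: m => [|n [en en1]|n [en en1]]; first by rewrite add0r.
  rewrite -addn1 PoszD -addrA; split=> //.
  by rewrite (ra n) (rb n) en en1.
have := ra (- n.+1%:Z); have := rb (- n.+1%:Z).
rewrite (_ : - n.+1%:Z + 1 = - n%:Z); last by lia.
rewrite (_ : - n.+1%:Z + 2 = - n%:Z + 1); last by lia.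
by rewrite -en -en1 => eb ea; split=> //; apply: (addrI (a (- n%:Z))); rewrite -ea.
Qed.

(** Cassini's identity at the even index 2n, with F_(2n-1) written as F_(2n+1) - F_(2n). *)
Lemma fib_cassini_even (n : nat) :
  (fib n.*2.+1)%:Z ^+ 2 =
  (fib n.*2)%:Z ^+ 2 + (fib n.*2)%:Z * (fib n.*2.+1)%:Z + 1.
Proof.
elim: n => [|n IHn] //; rewrite doubleS !fibSS !PoszD.
by ring: IHn.
Qed.

Lemma fibzN_even (n : nat) : fibz (- n.*2%:Z) = - (fib n.*2)%:Z.
Proof.
case: n => [|n] //; rewrite fibzN //= -signr_odd /= odd_double.
by rewrite expr1 mulN1r.
Qed.

Lemma fibzN_odd (n : nat) : fibz (- n.*2.+1%:Z) = (fib n.*2.+1)%:Z.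
Proof. by rewrite fibzN //= -signr_odd odd_double mul1r. Qed.

Lemma golden_exprS (R : comPzRingType) (x : R) (n : nat) :
  x ^+ 2 = x + 1 -> x ^+ n.+1 = (fib n.+1)%:R * x + (fib n)%:R.
Proof.
move=> gx; elim: n => [|n IHn]; first by rewrite expr1 mul1r addr0.
rewrite exprS IHn mulrDr mulrCA -expr2 gx fibSS natrD; ring.
Qed.

Lemma golden_conj (R : comPzRingType) (x : R) :
  x ^+ 2 = x + 1 -> (1 - x) ^+ 2 = (1 - x) + 1.
Proof. by move=> gx; ring: gx. Qed.

Lemma golden_of_fifth_root (R : comPzRingType) (z : R) :
  1 + z + z ^+ 2 + z ^+ 3 + z ^+ 4 = 0 ->
  (- (z ^+ 2 + z ^+ 3)) ^+ 2 = - (z ^+ 2 + z ^+ 3) + 1.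
Proof.
move=> z0; apply/eqP; rewrite -subr_eq0; apply/eqP.
(* For x = - (z^2 + z^3), the polynomial x^2 - x - 1 in z factors as (z^2 + z - 1)(1 + z + z^2 + z^3
   + z^4). *)
by rewrite -(mulr0 (z ^+ 2 + z - 1)) -z0; ring.
Qed.

Lemma golden_frobenius (L : fieldType) (p : nat) (z : L)
    (x := - (z ^+ 2 + z ^+ 3)) :
  p \in [pchar L] -> 1 + z + z ^+ 2 + z ^+ 3 + z ^+ 4 = 0 ->
  ((p %% 5 = 1 \/ p %% 5 = 4)%N -> x ^+ p = x) /\
  ((p %% 5 = 2 \/ p %% 5 = 3)%N -> x ^+ p = 1 - x).
Proof.
move=> pL z0; rewrite /x.
have z5 : z ^+ 5 = 1.
  by apply/eqP; rewrite -subr_eq0 -(mulr0 (z - 1)) -z0; apply/eqP; ring.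
(* Frobenius is additive and z^5 = 1, so x^p is x with z replaced by z^(p mod 5). *)
have -> : (- (z ^+ 2 + z ^+ 3)) ^+ p
    = - ((z ^+ (p %% 5)) ^+ 2 + (z ^+ (p %% 5)) ^+ 3).
  rewrite expr_mod // -(pFrobenius_autE pL) pFrobenius_autN.
  by rewrite rmorphD /= !pFrobenius_autX !pFrobenius_autE.
(* This form of x shows that the other root - (z + z^4) equals 1 - x. *)
have xE : - (z ^+ 2 + z ^+ 3) = 1 + z + z ^+ 4.
  by apply/eqP; rewrite -subr_eq0 -oppr_eq0 -z0; apply/eqP; ring.
split=> [] [] -> //.
- have -> : (z ^+ 4) ^+ 2 = z ^+ 5 * z ^+ 3 by ring.
  have -> : (z ^+ 4) ^+ 3 = (z ^+ 5) ^+ 2 * z ^+ 2 by ring.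
  by rewrite z5; ring.
- have -> : (z ^+ 2) ^+ 3 = z ^+ 5 * z by ring.
  by rewrite z5 xE; ring.
- have -> : (z ^+ 3) ^+ 2 = z ^+ 5 * z by ring.
  have -> : (z ^+ 3) ^+ 3 = z ^+ 5 * z ^+ 4 by ring.
  by rewrite z5 xE; ring.
Qed.

(** The difference of the roots x and 1 - x squares to the discriminant 5, nonzero in characteristic
    p <> 5. *)
Lemma golden_diff_neq0 (L : fieldType) (p : nat) (x : L) :
  p \in [pchar L] -> p != 5 -> x ^+ 2 = x + 1 -> 2 * x - 1 != 0.
Proof.
move=> pL p5 gx.
have e5 : (2 * x - 1) ^+ 2 = 5%:R by ring: gx.
have : (2 * x - 1) ^+ 2 != 0.
  by rewrite e5 -(dvdn_pcharf pL) dvdn_prime2 // (pcharf_prime pL).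
by apply: contraNneq => ->; rewrite expr0n.
Qed.

(** Expand x^p and (1 - x)^p = 1 - x^p linearly in the two roots; subtracting eliminates F_(p-1). *)
Lemma fib_pchar (L : fieldType) (p : nat) (x : L) :
  p \in [pchar L] -> x ^+ 2 = x + 1 ->
  (fib p)%:R * (2 * x - 1) = 2 * x ^+ p - 1 /\
  (fib p.-1)%:R = x ^+ p - (fib p)%:R * x.
Proof.
move=> pL gx; have p_gt0 := prime_gt0 (pcharf_prime pL).
have := golden_exprS _ _ p.-1 gx.
have := golden_exprS _ _ p.-1 (golden_conj _ _ gx).
rewrite prednK // -[(1 - x) ^+ p](pFrobenius_autE pL) rmorphB /= rmorph1.
rewrite pFrobenius_autE => e2 e1; split; last by rewrite e1; ring.
have -> : 2 * x ^+ p - 1 = x ^+ p - (1 - x ^+ p) by ring.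
by rewrite e2 e1; ring.
Qed.

Lemma fib_pchar_fixed (L : fieldType) (p : nat) (x : L) :
  p \in [pchar L] -> p != 5 -> x ^+ 2 = x + 1 -> x ^+ p = x ->
  (fib p.-1)%:R = 0 :> L /\ (fib p)%:R = 1 :> L.
Proof.
move=> pL p5 gx xp; have [] := fib_pchar _ _ _ pL gx; rewrite xp.
rewrite -[RHS]mul1r => /(mulIf (golden_diff_neq0 _ _ _ pL p5 gx)) -> ->.
by rewrite mul1r subrr.
Qed.

Lemma fib_pchar_swapped (L : fieldType) (p : nat) (x : L) :
  p \in [pchar L] -> p != 5 -> x ^+ 2 = x + 1 -> x ^+ p = 1 - x ->
  (fib p.-1)%:R = 1 :> L /\ (fib p)%:R = - 1 :> L.
Proof.
move=> pL p5 gx xp; have [] := fib_pchar _ _ _ pL gx; rewrite xp.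
rewrite [RHS](_ : _ = - 1 * (2 * x - 1)); last by ring.
by move=> /(mulIf (golden_diff_neq0 _ _ _ pL p5 gx)) -> ->; split=> //; ring.
Qed.

Lemma fifth_root_extension (p : nat) : prime p ->
  exists (L : fieldType) (z : L),
    p \in [pchar L] /\ 1 + z + z ^+ 2 + z ^+ 3 + z ^+ 4 = 0.
Proof.
move=> p_prime; pose q : {poly 'F_p} := \poly_(i < 5) 1.
have sq : size q = 5 by rewrite size_poly_eq ?oner_eq0.
have /FinSplittingFieldFor[/= L [rs Drs _]] : q != 0 by rewrite -size_poly_eq0 sq.
exists L.
(* Since [q] has degree 4, its list of roots is not empty. *)
have : size rs != 0.
  have := eqp_size Drs; rewrite size_map_poly sq size_prod_XsubC => -[<-] //.
case: rs Drs => // z rs Drs _; exists z; split.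
  by rewrite pchar_lalg pchar_Fp.
have : root (map_poly (GRing.in_alg L) q) z.
  by rewrite (eqp_root Drs) root_prod_XsubC mem_head.
rewrite /root horner_coef size_map_poly sq => /eqP z0.
rewrite -[RHS]z0 !big_ord_recl big_ord0 /= !coef_map /= !coef_poly /=.
by rewrite !scale1r; ring.
Qed.

(** Both sides satisfy the Fibonacci recurrence in m and agree at 0 and 1. *)
Lemma fibz_shift (L : fieldType) (c : int) (e : L) :
  (fibz c)%:~R = 0 :> L -> (fibz (c + 1))%:~R = e ->
  forall m, (fibz (c + m))%:~R = e * (fibz m)%:~R.
Proof.
move=> f0 f1; apply: int_rec2_uniq.
- by move=> m; rewrite !(addrA c) fibz_rec rmorphD.
- by move=> m; rewrite fibz_rec rmorphD /= mulrDr.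
- by rewrite addr0 f0 mulr0.
- by rewrite f1 mulr1.
Qed.

(** An integer that vanishes in characteristic p is divisible by p, so congruences can be checked in
    [L]. *)
Lemma eqz_mod_pchar (L : fieldType) (p : nat) (a b : int) :
  p \in [pchar L] -> a%:~R = b%:~R :> L -> (a = b %[mod p%:Z])%Z.
Proof.
move=> pL ab; apply/eqP; rewrite eqz_mod_dvd (dvdz_pcharf pL).
by rewrite rmorphB /= ab subrr.
Qed.

Lemma Hrk_double (k : int) : Hrk (2 * k) k = fibz (k + 1) ^+ 2.
Proof.
rewrite /Hrk (_ : 2 * k - k = k); last by ring.
by rewrite fibz_rec; ring.
Qed.

Lemma Hrk_fixed (L : fieldType) (p n : nat) : (0 < p)%N ->
  (fib p.-1)%:R = 0 :> L -> (fib p)%:R = 1 :> L ->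
  (Hrk p%:Z n.+1.*2%:Z)%:~R = (2 * fibz n.*2.+1%:Z ^+ 2)%:~R :> L.
Proof.
(* From here [p] denotes the predecessor of the original p, the index at which the Fibonacci value
   vanishes. *)
case: p => // p _ f0 f1.
have f m : (fibz (p%:Z + m))%:~R = (fibz m)%:~R :> L.
  by rewrite (fibz_shift L p%:Z 1) ?mul1r // -PoszD addn1.
(* This is F_(2n-1), written with natural indices so that n = 0 is covered. *)
have eN : fibz (1 - n.*2%:Z) = (fib n.*2.+1)%:Z - (fib n.*2)%:Z.
  have := fibz_rec (- n.*2.+1%:Z).
  rewrite (_ : - n.*2.+1%:Z + 2 = 1 - n.*2%:Z); last by lia.
  rewrite (_ : - n.*2.+1%:Z + 1 = - n.*2%:Z); last by lia.
  by move=> ->; rewrite fibzN_even fibzN_odd addrC.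
rewrite /Hrk intrB !intrM.
rewrite (_ : p.+1%:Z - n.+1.*2%:Z + 2 = p%:Z + (1 - n.*2%:Z)); last by lia.
rewrite (_ : p.+1%:Z - n.+1.*2%:Z + 1 = p%:Z + - n.*2%:Z); last by lia.
rewrite !f eN fibzN_even -!intrM -intrB; congr (_%:~R).
rewrite (_ : n.+1.*2%:Z + 1 = n.*2.+3%:Z); last by lia.
by rewrite doubleS /fibz !fibSS !PoszD; ring.
Qed.

Lemma Hrk_swapped (L : fieldType) (p n : nat) : (0 < p)%N ->
  (fib p.-1)%:R = 1 :> L -> (fib p)%:R = - 1 :> L ->
  (Hrk p%:Z n.*2.+1%:Z)%:~R = (2 * fibz n.*2.+1%:Z ^+ 2 - 1)%:~R :> L.
Proof.
case: p => // p _ f0 f1.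
have f2 : (fib p.+2)%:R = 0 :> L by rewrite fibSS natrD f0 f1 addNr.
have f3 : (fib p.+3)%:R = - 1 :> L by rewrite fibSS natrD f2 f1 add0r.
have f m : (fibz (p.+2%:Z + m))%:~R = (- fibz m)%:~R :> L.
  by rewrite (fibz_shift L p.+2%:Z (- 1)) ?mulN1r ?rmorphN // -PoszD addn1.
rewrite /Hrk intrB !intrM.
rewrite (_ : p.+1%:Z - n.*2.+1%:Z + 2 = p.+2%:Z + - n.*2%:Z); last by lia.
rewrite (_ : p.+1%:Z - n.*2.+1%:Z + 1 = p.+2%:Z + - n.*2.+1%:Z); last by lia.
rewrite !f fibzN_even fibzN_odd -!intrM -intrB; congr (_%:~R).
rewrite (_ : n.*2.+1%:Z + 1 = n.*2.+2%:Z); last by lia.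
(* What remains is F_(2n+2) F_(2n) + F_(2n+1)^2 = 2 F_(2n+1)^2 - 1, which is Cassini's identity. *)
by rewrite /fibz fibSS !PoszD fib_cassini_even; ring: (fib_cassini_even n).
Qed.

Lemma eqz_mod5 (p : nat) (r : nat) (c : int) :
  (c = r%:Z %[mod 5])%Z -> (r < 5)%N -> (p%:Z = c %[mod 5])%Z -> (p %% 5)%N = r.
Proof. by move=> -> lt_r5; rewrite !modz_nat (modn_small lt_r5) => -[]. Qed.

Theorem theorem2p8 (p : nat) (t : int) (p_prime : prime p) (t_gt0 : 0 < t) :
  ((p%:Z = 1 %[mod 5])%Z \/ (p%:Z = -1 %[mod 5])%Z ->
    (Hrk p%:Z (2 * t) = 2 * Hrk (4 * (t - 1)) (2 * (t - 1)) %[mod p%:Z])%Z /\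
    (2 * Hrk (4 * (t - 1)) (2 * (t - 1)) = 2 * fibz (2 * t - 1) ^+ 2
       %[mod p%:Z])%Z)
  /\
  ((p%:Z = 2 %[mod 5])%Z \/ (p%:Z = -2 %[mod 5])%Z ->
    (Hrk p%:Z (2 * t + 1) = 2 * Hrk (4 * t) (2 * t) - 1 %[mod p%:Z])%Z /\
    (2 * Hrk (4 * t) (2 * t) - 1 = 2 * fibz (2 * t + 1) ^+ 2 - 1
       %[mod p%:Z])%Z).
Proof.
have H2 (u : int) : Hrk (4 * u) (2 * u) = fibz (2 * u + 1) ^+ 2.
  by rewrite -Hrk_double; congr Hrk; ring.
have [L [z [pL z0]]] := fifth_root_extension _ p_prime.
have [fix_x swap_x] := golden_frobenius _ _ _ pL z0.
have gx := golden_of_fifth_root _ _ z0.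
have p_gt0 := prime_gt0 p_prime.
(* The second congruence of each part thereby becomes a plain equality. *)
rewrite !H2 (_ : 2 * (t - 1) + 1 = 2 * t - 1); last by ring.
split=> hp; split=> //; apply: (eqz_mod_pchar _ _ _ _ pL).
  have {}hp : (p %% 5 = 1 \/ p %% 5 = 4)%N.
    by case: hp => /eqz_mod5 h; [left|right]; apply: h.
  have p5 : p != 5 by apply: contraPneq hp => ->; case.
  have [f0 f1] := fib_pchar_fixed _ _ _ pL p5 gx (fix_x hp).
  (* As t > 0, n = |t - 1| gives 2(n + 1) = 2t and 2n + 1 = 2t - 1. *)
  have := Hrk_fixed _ _ `|t - 1|%N p_gt0 f0 f1.
  rewrite (_ : (`|t - 1|%N.+1.*2)%:Z = 2 * t); last by lia.
  by rewrite (_ : (`|t - 1|%N.*2.+1)%:Z = 2 * t - 1); last by lia.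
have {}hp : (p %% 5 = 2 \/ p %% 5 = 3)%N.
  by case: hp => /eqz_mod5 h; [left|right]; apply: h.
have p5 : p != 5 by apply: contraPneq hp => ->; case.
have [f0 f1] := fib_pchar_swapped _ _ _ pL p5 gx (swap_x hp).
have := Hrk_swapped _ _ `|t|%N p_gt0 f0 f1.
by rewrite (_ : (`|t|%N.*2.+1)%:Z = 2 * t + 1); last by lia.
Qed.
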